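(* Let $(T, M)$ be a complete local ring with $\dim(T) \ge 2$. Then $|\operatorname{Spec}(T)| = |T|$, and in particular, $T$ and $\operatorname{Spec}(T)$ are uncountable.
   Context: All rings are commutative with $1$. ''Local'' means Noetherian with exactly one maximal ideal; $(T,M)$ local means $M$ is the maximal ideal of $T$; ''complete'' means complete with respect to the $M$-adic topology. $\dim$ is Krull dimension. *)

(* Defs.v *)
From mathcomp Require Import all_boot all_order all_algebra.
From mathcomp Require Import all_classical all_reals ereal.

Set Implicit Arguments.
Unset Strict Implicit.
Unset Printing Implicit Defensive.

Import Order.TTheory GRing.Theory Num.Theory.

Local Open Scope classical_set_scope.
Local Open Scope ring_scope.

Section Ideals.
Variable T : comNzRingType.
Implicit Types (I J M P : set T).

(* Ideals are the T-submodules of the regular module T^o; the unit ideal is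
   included.  [idealr_closed], used below, is the proper-ideal variant. *)
Definition ideal I : Prop := submod_closed ([in I] : {pred T^o}).

Definition ideal_gen (A : set T) : set T := smallest ideal A.

Definition ideal_mul I J : set T := ideal_gen [set x * y | x in I & y in J].

Definition ideal_exp I (n : nat) : set T := iter n (ideal_mul I) [set: T].

Definition noetherian : Prop :=
  forall I, ideal I -> exists s : seq T, I = ideal_gen [set` s].

Definition prime_ideal P : Prop :=
  idealr_closed [in P] /\ prime_idealr_closed [in P].

Definition maximal_ideal M : Prop :=
  idealr_closed [in M] /\
  forall I, idealr_closed [in I] -> M `<=` I -> I = M.

Definition local_ring M : Prop :=
  [/\ noetherian, maximal_ideal M & forall N, maximal_ideal N -> N = M].

Definition adic_cauchy I (u : nat -> T) : Prop :=
  forall n, exists N, forall i j, (N <= i)%N -> (N <= j)%N ->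
    ideal_exp I n (u i - u j).

Definition adic_cvg I (u : nat -> T) (l : T) : Prop :=
  forall n, exists N, forall i, (N <= i)%N -> ideal_exp I n (u i - l).

(* The powers of I form a countable base of neighbourhoods of 0, so
   sequences suffice.  Separatedness is not required: for the maximal ideal of
   a Noetherian local ring it is Krull's intersection theorem. *)
Definition adic_complete I : Prop :=
  forall u, adic_cauchy I u -> exists l, adic_cvg I u l.

End Ideals.

Definition Spec (T : comNzRingType) : set (set T) := [set P | prime_ideal P].
Arguments Spec T : clear implicits.

(* p 0, ..., p n is a strictly increasing chain of primes of length n;
   the values of p beyond n are irrelevant. *)
Definition prime_chain (T : comNzRingType) (n : nat) (p : nat -> set T) : Prop :=
  (forall i, (i <= n)%N -> Spec T (p i)) /\
  (forall i, (i < n)%N -> p i `<` p i.+1).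

(* The supremum is taken in the integers extended by -oo and +oo. *)
Definition krull_dim (T : comNzRingType) : \bar int :=
  supremum -oo%E [set n%:Z%:E | n in [set n | exists p, @prime_chain T n p]].

(* [supremum] returns a default value when there is no least upper bound; this
   characterization shows that the default plays no role for a set of chain
   lengths. *)
Lemma le_krull_dimP (T : comNzRingType) (n : nat) :
  (n%:Z%:E <= krull_dim T)%E <->
  exists2 m, (n <= m)%N & exists p, @prime_chain T m p.
Proof.
rewrite /krull_dim; set S := [set k | _]; set A := image _ _; split.
  move=> nS; apply: contrapT => h.
  suff : (supremum -oo%E A <= (n%:Z - 1)%:E)%E.
    by move/(le_trans nS); rewrite lee_fin lerDl.
  rewrite /supremum; case: ifPn => _; first exact: leNye.
  case: xgetP => [y _ [_]|_]; [apply|exact: leNye] => _ [m Sm <-].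
  rewrite lee_fin lerBrDr lezD1 ltz_nat ltnNge; apply/negP => nm.
  by apply: h; exists m.
move=> [m nm Sm].
have [x [ubx lbx]] : supremums A !=set0.
  have [[N bN]|nb] := pselect (exists N, forall k, S k -> (k <= N)%N).
    have exS : exists k, `[< S k >] by exists m; apply/asboolP.
    have bS k : `[< S k >] -> (k <= N)%N by move/asboolP; exact: bN.
    have [k /asboolP Sk kmax] := ex_maxnP exS bS.
    exists k%:Z%:E; split; last by move=> y; apply; exists k.
    by move=> _ [j Sj <-]; rewrite lee_fin lez_nat kmax//; apply/asboolP.
  exists +oo%E; split => [y _|y uby]; first exact: leey.
  case: y uby => [z|//|] uby; exfalso.
  - apply: nb; exists `|z|%N => k Sk.
    have := uby k%:Z%:E (ex_intro2 _ _ k Sk erefl).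
    by rewrite lee_fin => kz; rewrite -lez_nat abszE (le_trans kz) ?ler_norm.
  - by have := uby m%:Z%:E (ex_intro2 _ _ m Sm erefl).
have -> : supremum -oo%E A = x.
  rewrite /supremum ifF; last by apply/negbTE/set0P; exists m%:Z%:E, m.
  case: xgetP => [y _ [uby lby]|/(_ x)[]//]; apply/eqP.
  by rewrite eq_le lby// lbx.
apply: le_trans (ubx m%:Z%:E _); first by rewrite lee_fin lez_nat.
by exists m.
Qed.

(* Main.v *)
Require Import Defs.
From mathcomp Require Import all_boot all_order all_algebra.
From mathcomp Require Import all_classical all_reals ereal.
From mathcomp Require Import ring.

Set Implicit Arguments.
Unset Strict Implicit.
Unset Printing Implicit Defensive.

Import GRing.Theory.

Local Open Scope classical_set_scope.
Local Open Scope card_scope.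
Local Open Scope ring_scope.

(** Write k for the residue field T/M. Both T and Spec T are compared with the
    set of sequences of digits, that is of sequences with values in a system of
    representatives of k.

    From T to digit sequences ([digit_expansion]): expanding an element along
    generators of M, then expanding its coefficients, and so on, attaches a
    digit to every finite word. By Krull's intersection theorem
    ([krull_intersection]) the digits determine the element. The same holds for
    finite lists of elements of T ([digit_expansion_seq]), and a prime is
    determined by a finite list of generators, so Spec T also embeds in the
    set of digit sequences.

    From digit sequences to Spec T ([digit_seq_primes]): choose primes
    P < P' < M with P maximal for the existence of such a P', and elements x, y
    of M such that M is the only prime containing P, x and y
    ([two_parameters]). Completeness gives the value L(a) of the power series
    with coefficients a at y. By Krull's principal ideal theorem
    ([principal_ideal_theorem]) some prime Q(a) other than M contains P and
    x - y L(a). It does not contain y, for otherwise it would contain x and be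
    M. If a and b first differ at index n, then y (L(a) - L(b)) is y^(n+1) times
    a unit ([power_series_inj]), and a common prime Q(a) = Q(b) would contain
    it, hence y. So Q is injective. The same computation shows that L is injective,
    so digit sequences embed in T too.

    Schroeder-Bernstein gives the equality of cardinals. Since 0 and 1 have
    different representatives, the digit sequences include a copy of the binary
    sequences, so T and Spec T are uncountable.

    Most arguments are Noetherian inductions on ideals ([noetherian_ind]).
    Finite length of T/K is expressed by [finite_length_ind], which yields both
    the inclusion of a power of M in K and the descending chain condition used for
    the principal ideal theorem. *)

(** * Ideals *)

Section Ideals.
Variable T : comNzRingType.
Implicit Types (I J K A B M P Q : set T) (a b r t u v w x y z m : T).

Lemma idealP I : ideal I <->
  [/\ I 0, forall x y, I x -> I y -> I (x + y) & forall a x, I x -> I (a * x)].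
Proof.
split.
  case=> /set_mem I0 IL.
  have IL' a x y : I x -> I y -> I (a * x + y).
    by move=> Ix Iy; apply: set_mem; apply: (IL a); exact: mem_set.
  split=> // [x y Ix Iy|a x Ix]; first by rewrite -[x]mul1r; exact: IL'.
  by rewrite -[a * x]addr0; exact: IL'.
case=> I0 ID IM; split; first exact: mem_set.
move=> a x y /set_mem Ix /set_mem Iy; apply/mem_set/ID => //; exact: IM.
Qed.

Lemma ideal0 I : ideal I -> I 0.
Proof. by case/idealP. Qed.

Lemma idealD I x y : ideal I -> I x -> I y -> I (x + y).
Proof. by case/idealP=> _ ID _; exact: ID. Qed.

Lemma ideal_mull I a x : ideal I -> I x -> I (a * x).
Proof. by case/idealP=> _ _ IM; exact: IM. Qed.

Lemma ideal_mulr I a x : ideal I -> I x -> I (x * a).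
Proof. by rewrite mulrC; exact: ideal_mull. Qed.

Lemma idealB I x y : ideal I -> I x -> I y -> I (x - y).
Proof.
move=> idI Ix Iy; rewrite -mulN1r.
by apply: idealD => //; exact: ideal_mull.
Qed.

Lemma ideal_sum I n (F : 'I_n -> T) :
  ideal I -> (forall i, I (F i)) -> I (\sum_i F i).
Proof.
move=> idI IF; apply: (big_ind I) => // [|x y]; first exact: ideal0.
exact: idealD.
Qed.

Lemma idealT : ideal [set: T].
Proof. exact/idealP. Qed.

Lemma ideal_zero : ideal [set 0 : T].
Proof.
by apply/idealP; split=> [|x y /= -> ->|a x /= ->]; rewrite ?addr0 ?mulr0.
Qed.

Lemma ideal_properP I : idealr_closed [in I] <-> ideal I /\ ~ I 1.
Proof.
split=> [[I0 I1 IL]|[[I0 IL] I1]]; last first.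
  by split=> //; apply/negP => /set_mem.
split; first by split=> // a x y xI yI; exact: IL.
by move=> /mem_set; exact/negP.
Qed.

Lemma ideal_smallest (G : set T) : ideal (ideal_gen G).
Proof.
apply/idealP; split.
- by move=> I [idI _]; exact: ideal0.
- by move=> x y xG yG I GI; apply: idealD; [case: GI|exact: xG|exact: yG].
- by move=> a x xG I GI; apply: ideal_mull; [case: GI|exact: xG].
Qed.

Lemma ideal_mul_mem A B a b : A a -> B b -> ideal_mul A B (a * b).
Proof. by move=> Aa Bb I [_]; apply; exists a => //; exists b. Qed.

Lemma ideal_mul_sub A B I : ideal I ->
  (forall a b, A a -> B b -> I (a * b)) -> ideal_mul A B `<=` I.
Proof.
move=> idI ABI; apply: smallest_sub => // _ [a Aa [b Bb <-]]; exact: ABI.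
Qed.

Lemma ideal_exp_ideal M n : ideal (ideal_exp M n).
Proof. by case: n => [|n]; [exact: idealT|exact: ideal_smallest]. Qed.

Lemma ideal_expS M n : ideal_exp M n.+1 `<=` ideal_exp M n.
Proof.
apply: ideal_mul_sub => [|m u _ Mu]; first exact: ideal_exp_ideal.
by apply: ideal_mull => //; exact: ideal_exp_ideal.
Qed.

Lemma ideal_exp_le M n k : (n <= k)%N -> ideal_exp M k `<=` ideal_exp M n.
Proof.
move=> /subnK <-; elim: (k - n)%N => // i IH.
by apply: subset_trans IH; exact: ideal_expS.
Qed.

Lemma ideal_exp_mem M y n : M y -> ideal_exp M n (y ^+ n).
Proof.
by move=> My; elim: n => //= n IH; rewrite exprS; exact: ideal_mul_mem.
Qed.

(** The linear combinations of s form an ideal that contains s. *)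
Lemma ideal_gen_seqP (s : seq T) x : ideal_gen [set` s] x ->
  exists c : nat -> T, x = \sum_(i < size s) c i * s`_i.
Proof.
pose L := [set x | exists c : nat -> T, x = \sum_(i < size s) c i * s`_i].
suff: ideal_gen [set` s] `<=` L by apply.
apply: smallest_sub.
  apply/idealP; split.
  - by exists (fun=> 0); rewrite big1// => i _; rewrite mul0r.
  - move=> _ _ [c ->] [d ->]; exists (fun i => c i + d i).
    by rewrite -big_split; apply: eq_bigr => i _; rewrite mulrDl.
  - move=> a _ [c ->]; exists (fun i => a * c i).
    by rewrite mulr_sumr; apply: eq_bigr => i _; rewrite mulrA.
move=> a /= sa; have ia : (index a s < size s)%N by rewrite index_mem.
exists (fun i => (i == index a s)%:R).
rewrite (bigD1 (Ordinal ia))//= eqxx mul1r nth_index// big1 ?addr0//.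
by move=> i; rewrite -val_eqE/= => /negPf ->; rewrite mul0r.
Qed.

(** The ideal A + (a). *)
Definition adjoin A a : set T := [set x | exists r, A (x - r * a)].

Lemma adjoin_ideal A a : ideal A -> ideal (adjoin A a).
Proof.
move=> idA; apply/idealP; split.
- by exists 0; rewrite mul0r subr0; exact: ideal0.
- move=> x y [r Ar] [s As]; exists (r + s).
  have -> : x + y - (r + s) * a = (x - r * a) + (y - s * a) by ring.
  exact: idealD.
- move=> c x [r Ar]; exists (c * r).
  have -> : c * x - c * r * a = c * (x - r * a) by ring.
  exact: ideal_mull.
Qed.

Lemma sub_adjoin A a : A `<=` adjoin A a.
Proof. by move=> x Ax; exists 0; rewrite mul0r subr0. Qed.

Lemma mem_adjoin A a : ideal A -> adjoin A a a.
Proof. by move=> idA; exists 1; rewrite mul1r subrr; exact: ideal0. Qed.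

Lemma adjoin_sub A a B : ideal B -> A `<=` B -> B a -> adjoin A a `<=` B.
Proof.
move=> idB AB Ba x [r /AB Br]; rewrite -(subrK (r * a) x).
by apply: idealD => //; exact: ideal_mull.
Qed.

Lemma proper_adjoin A a : ideal A -> ~ A a -> A `<` adjoin A a.
Proof.
by move=> idA nAa; split; [exact: sub_adjoin|move/(_ a (mem_adjoin _ idA))].
Qed.

(** The ideal (A : a). *)
Definition colon A a : set T := [set t | A (t * a)].

Lemma colon_ideal A a : ideal A -> ideal (colon A a).
Proof.
move=> idA; rewrite /colon; apply/idealP; split=> /= [|x y Ax Ay|c x Ax].
- by rewrite mul0r; exact: ideal0.
- by rewrite mulrDl; exact: idealD.
- by rewrite -mulrA; exact: ideal_mull.
Qed.

Lemma prime_idealP P : prime_ideal P <->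
  [/\ ideal P, ~ P 1 & forall x y, P (x * y) -> P x \/ P y].
Proof.
split=> [[/ideal_properP[idP P1] PM]|[idP P1 PM]].
  split=> // x y /mem_set Pxy.
  by have /orP[/set_mem|/set_mem] := PM x y Pxy; [left|right].
split; first exact/ideal_properP.
by move=> x y /set_mem /PM [] /mem_set H; apply/orP; [left|right].
Qed.

Lemma prime_is_ideal P : prime_ideal P -> ideal P.
Proof. by case/prime_idealP. Qed.

Lemma primeM P x y : prime_ideal P -> P (x * y) -> P x \/ P y.
Proof. by case/prime_idealP => _ _; apply. Qed.

Lemma primeX P x n : prime_ideal P -> P (x ^+ n) -> P x.
Proof.
move=> prP; elim: n => [|n IH]; first by case/prime_idealP: prP.
by rewrite exprS => /(primeM prP)[//|/IH].
Qed.

Lemma not_primeP P : ideal P -> ~ P 1 -> ~ prime_ideal P ->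
  exists x y, [/\ P (x * y), ~ P x & ~ P y].
Proof.
move=> idP P1 nprP; apply: contrapT => h; apply: nprP; apply/prime_idealP.
split=> // x y Pxy; apply: contrapT => /not_orP[Px Py].
by apply: h; exists x, y.
Qed.

End Ideals.

(** * Noetherian rings *)

Section Noetherian.
Variable T : comNzRingType.
Hypothesis T_noeth : noetherian T.
Implicit Types (I J K A B M P Q : set T) (a b r t u v w x y z m : T).

(** If the property failed at A, failures would climb forever; the union of
    the resulting chain is an ideal, and a finite set of generators of it
    already lies in one member of the chain. *)
Lemma noetherian_ind (Pr : set T -> Prop) :
  (forall A, ideal A -> (forall B, ideal B -> A `<` B -> Pr B) -> Pr A) ->
  forall A, ideal A -> Pr A.
Proof.
move=> step A idA; apply: contrapT => nPA.
pose bad := {A : set T | ideal A /\ ~ Pr A}.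
have next (C : bad) : {D : bad | sval C `<` sval D}.
  apply: cid; case: C => C [idC nPC] /=; apply: contrapT => h; apply: nPC.
  apply: step => // B idB CB; apply: contrapT => nPB; apply: h.
  by exists (exist _ B (conj idB nPB)).
have [f [_ fS]] := dependent_choice next (exist _ A (conj idA nPA)).
pose J n := sval (f n).
have idJ n : ideal (J n) by rewrite /J; case: (f n) => ? [].
have JS n k : (n <= k)%N -> J n `<=` J k.
  move=> /subnK <-; elim: (k - n)%N => // i IH.
  by apply: subset_trans IH _; case: (fS (i + n)%N).
pose U := [set x | exists n, J n x].
have idU : ideal U.
  apply/idealP; split; first by exists 0%N; exact: ideal0.
    move=> x y [n Jx] [k Jy]; exists (maxn n k); apply: idealD => //.
      by apply: JS Jx; exact: leq_maxl.
    by apply: JS Jy; exact: leq_maxr.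
  by move=> a x [n Jx]; exists n; exact: ideal_mull.
have [s Us] := T_noeth idU.
have {}sU x : x \in s -> U x by move=> xs; rewrite Us; exact: sub_gen_smallest.
have [n sn] : exists n, forall x, x \in s -> J n x.
  elim: s {Us} sU => [|a s IH] sU; first by exists 0%N.
  have [n sn] : exists n, forall x, x \in s -> J n x.
    by apply: IH => x xs; apply: sU; rewrite inE xs orbT.
  have [k Jk] := sU a (mem_head _ _).
  exists (maxn n k) => x; rewrite inE => /orP[/eqP ->|/sn].
    by apply: JS Jk; exact: leq_maxr.
  by apply: JS; exact: leq_maxl.
have UJ : U `<=` J n by rewrite Us; apply: smallest_sub.
by case: (fS n) => _; apply=> x Jx; apply: UJ; exists n.+1.
Qed.

Lemma noetherian_acc (J : nat -> set T) : (forall n, ideal (J n)) ->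
  (forall n, J n `<=` J n.+1) -> exists n, J n.+1 `<=` J n.
Proof.
move=> idJ JS.
suff H A : ideal A -> forall n, A = J n -> exists k, J k.+1 `<=` J k.
  exact: (H (J 0%N) (idJ 0%N) 0%N erefl).
move: A; apply: noetherian_ind => A _ IH n An.
have [h|h] := pselect (J n.+1 `<=` J n); first by exists n.
by apply: (IH (J n.+1) (idJ _)) erefl; rewrite An; split.
Qed.

(** An associated prime: among the proper colon ideals over A, one that
    admits no larger one is prime. *)
Lemma colon_prime A : ideal A -> ~ A 1 ->
  exists2 a, ~ A a & prime_ideal (colon A a).
Proof.
move=> idA A1.
suff H C : ideal C -> forall a, ~ A a -> C = colon A a ->
    exists2 b, ~ A b & prime_ideal (colon A b).
  exact: (H (colon A 1) (colon_ideal 1 idA) 1 A1 erefl).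
move: C; apply: noetherian_ind => C _ IH a Aa Ca.
have [h|h] := pselect (prime_ideal (colon A a)); first by exists a.
have [|u [v [Auv Au Av]]] := not_primeP (colon_ideal a idA) _ h.
  by rewrite /colon/= mul1r.
apply: (IH (colon A (v * a)) (colon_ideal _ idA)) _ (v * a) Av erefl.
rewrite Ca; split=> [x|/(_ u)]; rewrite /colon/=.
  by rewrite mulrCA; exact: ideal_mull.
by rewrite mulrA => /(_ Auv).
Qed.

(** Going up from K, each step adjoins an element a whose annihilator modulo the
    previous ideal is an associated prime, hence contains M. The series ends at T
    by the ascending chain condition; the induction runs down it. When M is
    maximal this says that T/K has finite length. *)
Lemma finite_length_ind K M (Pr : set T -> Prop) : ideal K ->
  (forall Q, prime_ideal Q -> K `<=` Q -> M `<=` Q) ->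
  Pr [set: T] ->
  (forall A a, ideal A -> K `<=` A -> ~ A a -> (forall m, M m -> A (m * a)) ->
     Pr (adjoin A a) -> Pr A) ->
  Pr K.
Proof.
move=> idK KM PT step.
suff H A : ideal A -> K `<=` A -> Pr A by exact: H.
move: A; apply: noetherian_ind => A idA IH KA.
have [A1|A1] := pselect (A 1).
  suff -> : A = [set: T] by [].
  by apply/seteqP; split=> // x _; rewrite -[x]mulr1; exact: ideal_mull.
have [a Aa prA] := colon_prime idA A1.
apply: (step _ a) => //.
  by apply: (KM _ prA) => x /KA Ax; exact: ideal_mulr.
apply: IH; [exact: adjoin_ideal|exact: proper_adjoin|].
by apply: subset_trans KA _; exact: sub_adjoin.
Qed.

(** Noetherian induction: a nonprime proper ideal is replaced by two larger
    ideals that have together the same primes above them. *)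
Lemma minimal_primes A : ideal A -> exists s : seq (set T),
  (forall Q, Q \in s -> prime_ideal Q /\ A `<=` Q) /\
  (forall Q, prime_ideal Q -> A `<=` Q -> exists2 Q', Q' \in s & Q' `<=` Q).
Proof.
move: A; apply: noetherian_ind => A idA IH.
have [A1|A1] := pselect (A 1).
  by exists [::]; split=> // Q /prime_idealP[_ Q1 _] /(_ 1 A1).
have [prA|nprA] := pselect (prime_ideal A).
  exists [:: A]; split=> [Q|Q _ AQ]; first by rewrite inE => /eqP ->; split.
  by exists A => //; exact: mem_head.
(* A prime over A contains u or v, so it lies over A + (u) or A + (v). *)
have [u [v [Auv Au Av]]] := not_primeP idA A1 nprA.
have [s [s1 s2]] := IH _ (adjoin_ideal u idA) (proper_adjoin idA Au).
have [t [t1 t2]] := IH _ (adjoin_ideal v idA) (proper_adjoin idA Av).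
exists (s ++ t); split=> [Q|Q prQ AQ].
  rewrite mem_cat => /orP[/s1|/t1] [prQ AQ]; split=> //;
  by apply: subset_trans AQ; exact: sub_adjoin.
have [Qu|Qv] := primeM prQ (AQ _ Auv).
- have [|Q' Q's Q'Q] := s2 Q prQ.
    by apply: adjoin_sub => //; exact: prime_is_ideal.
  by exists Q' => //; rewrite mem_cat Q's.
- have [|Q' Q's Q'Q] := t2 Q prQ.
    by apply: adjoin_sub => //; exact: prime_is_ideal.
  by exists Q' => //; rewrite mem_cat Q's orbT.
Qed.

End Noetherian.

Section PrimeAvoidance.
Variable T : comNzRingType.
Implicit Types (I P Q : set T) (s : seq (set T)).

(** Supplies the correction term of prime avoidance: a product of elements
    taken from I and from each member of s that is not inside Q, all chosen
    outside the prime Q. *)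
Lemma prime_separation I Q s : ideal I -> prime_ideal Q -> ~ I `<=` Q ->
  (forall P, P \in s -> ideal P) ->
  exists e, [/\ I e, ~ Q e &
    forall P, P \in s -> ~ P `<=` Q -> P e].
Proof.
move=> idI prQ IQ; elim: s => [|P s IH] ids.
  by move/existsNP: IQ => [e /not_implyP[Ie Qe]]; exists e.
have [|e [Ie Qe es]] := IH; first by move=> R Rs; apply: ids; rewrite inE Rs orbT.
have [PQ|PQ] := pselect (P `<=` Q).
  by exists e; split=> // R; rewrite inE => /orP[/eqP ->|/es].
move/existsNP: (PQ) => [p /not_implyP[Pp Qp]]; exists (p * e); split.
- exact: ideal_mull.
- by move/(primeM prQ) => [].
- move=> R; rewrite inE => /orP[/eqP -> _|Rs RQ].
    by apply: ideal_mulr => //; apply: ids; exact: mem_head.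
  by apply: ideal_mull; [apply: ids; rewrite inE Rs orbT|exact: es].
Qed.

(** Adding one prime Q to the list, an element y that avoids the others is kept
    if it avoids Q; otherwise y + e works, with e from [prime_separation]. The
    members of s inside Q are avoided because y + e is not in Q, the remaining
    ones because they contain e and not y. *)
Lemma prime_avoidance I s : ideal I ->
  (forall P, P \in s -> prime_ideal P /\ ~ I `<=` P) ->
  exists2 y, I y & forall P, P \in s -> ~ P y.
Proof.
move=> idI; elim: s => [|Q s IH] Hs; first by exists 0 => //; exact: ideal0.
have [|y Iy ys] := IH; first by move=> P Ps; apply: Hs; rewrite inE Ps orbT.
have [prQ IQ] := Hs Q (mem_head _ _).
have ids P : P \in s -> ideal P.
  by move=> Ps; apply: prime_is_ideal; case: (Hs P); rewrite ?inE ?Ps ?orbT.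
have [Qy|Qy] := pselect (Q y); last first.
  by exists y => // P; rewrite inE => /orP[/eqP ->|/ys].
have [e [Ie Qe es]] := prime_separation idI prQ IQ ids.
have Qye : ~ Q (y + e).
  move=> Q1; apply: Qe; rewrite -(addKr y e) addrC.
  by apply: idealB => //; exact: prime_is_ideal.
exists (y + e) => [|P]; first exact: idealD.
rewrite inE => /orP[/eqP -> //|Ps Pye].
have [PQ|/(es _ Ps) Pe] := pselect (P `<=` Q); first by apply: Qye; exact: PQ.
by apply: (ys _ Ps); rewrite -(addrK e y); apply: idealB => //; exact: ids.
Qed.

End PrimeAvoidance.

(** * Noetherian local rings *)

Section LocalRing.
Variables (T : comNzRingType) (M : set T).
Hypothesis T_local : local_ring M.
Implicit Types (I J K A B P Q : set T) (a b r t u v w x y z m : T).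

Lemma local_noetherian : noetherian T.
Proof. by case: T_local. Qed.
Let T_noeth := local_noetherian.

Lemma local_proper : ideal M /\ ~ M 1.
Proof. by apply/ideal_properP; case: T_local => _ []. Qed.

Lemma local_ideal : ideal M.
Proof. by case: local_proper. Qed.
Let idM := local_ideal.

(** Noetherian induction climbs from A to a maximal ideal, which is M. *)
Lemma proper_sub_local A : ideal A -> ~ A 1 -> A `<=` M.
Proof.
move: A; apply: (noetherian_ind T_noeth) => A idA IH A1.
have [[B [idB AB B1]]|h] := pselect (exists B, [/\ ideal B, A `<` B & ~ B 1]).
  by case: (AB) => AsubB _; apply: subset_trans AsubB (IH B idB AB B1).
suff maxA : maximal_ideal A by case: T_local => _ _ /(_ A maxA) ->.
split; first exact/ideal_properP.
move=> B /ideal_properP[idB B1] AB; apply/seteqP; split=> //.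
by apply: contrapT => BA; apply: h; exists B.
Qed.

Lemma local_unit t : ~ M t -> exists s, s * t = 1.
Proof.
move=> Mt; apply: contrapT => h; apply: Mt.
apply: (@proper_sub_local (adjoin [set 0] t)).
- exact: adjoin_ideal (ideal_zero T).
- move=> [r]/= /eqP; rewrite subr_eq0 => /eqP r1.
  by apply: h; exists r.
- exact: mem_adjoin (ideal_zero T).
Qed.

Lemma local_unit1B m : M m -> exists s, s * (1 - m) = 1.
Proof.
move=> Mm; apply: local_unit => M1m; case: local_proper => _; apply.
by rewrite -(subrK m 1); exact: idealD.
Qed.

(** If some a in I lies outside N, where J <= N and all larger ideals contain
    I, then I <= N + (a), so a is in J + M I <= N + M a, and 1 - m is a unit. *)
Lemma nakayama I J : ideal J ->
  (forall t, I t -> exists2 u, ideal_mul M I u & J (t - u)) -> I `<=` J.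
Proof.
move=> idJ IJ.
suff H N : ideal N -> J `<=` N -> I `<=` N by exact: H.
move: N; apply: (noetherian_ind T_noeth) => N idN IH JN a Ia.
apply: contrapT => Na.
have IN : I `<=` adjoin N a.
  apply: IH; [exact: adjoin_ideal|exact: proper_adjoin|].
  exact: subset_trans JN (sub_adjoin _).
pose NMa := [set x | exists2 m, M m & N (x - m * a)].
have MI_NMa : ideal_mul M I `<=` NMa.
  apply: ideal_mul_sub => [|m b Mm /IN[r Nr]]; last first.
    exists (m * r); first exact: ideal_mulr.
    have -> : m * b - m * r * a = m * (b - r * a) by ring.
    exact: ideal_mull.
  apply/idealP; split.
  - by exists 0; [|rewrite mul0r subr0]; exact: ideal0.
  - move=> x y [m Mm Nx] [n Mn Ny]; exists (m + n); first exact: idealD.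
    have -> : x + y - (m + n) * a = (x - m * a) + (y - n * a) by ring.
    exact: idealD.
  - move=> c x [m Mm Nx]; exists (c * m); first exact: ideal_mull.
    have -> : c * x - c * m * a = c * (x - m * a) by ring.
    exact: ideal_mull.
have [u /MI_NMa[m Mm Nu] /JN Nau] := IJ a Ia.
have [s s1] := local_unit1B Mm; apply: Na.
have -> : a = s * ((a - u) + (u - m * a)).
  by rewrite -[LHS]mul1r -s1; ring.
by apply: ideal_mull => //; exact: idealD.
Qed.

(** Each step of a composition series of T/K costs one factor M. *)
Lemma exp_local_sub K : ideal K ->
  (forall Q, prime_ideal Q -> K `<=` Q -> M `<=` Q) ->
  exists n, ideal_exp M n `<=` K.
Proof.
move=> idK KM.
apply: (finite_length_ind T_noeth (Pr := fun A => exists n, ideal_exp M n `<=` A)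
  idK KM); first by exists 0%N => x.
move=> A a idA _ _ MaA [n MnA]; exists n.+1.
apply: ideal_mul_sub => // m u Mm /MnA[r Aur].
have -> : m * u = m * (u - r * a) + r * (m * a) by ring.
by apply: idealD => //; apply: ideal_mull => //; exact: MaA.
Qed.

(** Krull's intersection theorem. Let I be the intersection and K an ideal
    maximal among those with MI <= K and K /\ I <= MI. For m in M the ascending
    chain (K : m^n) stops, and then K + (m^n) still meets I inside MI, so m^n
    is in K. Thus K contains a power of M, hence I, so I = MI = 0. *)
Lemma krull_intersection x : (forall n, ideal_exp M n x) -> x = 0.
Proof.
pose I := [set x | forall n, ideal_exp M n x].
suff I0 : I `<=` [set 0] by exact: I0.
have idI : ideal I.
  apply/idealP; split=> [n|y z Iy Iz n|c y Iy n].
  - by apply: ideal0; exact: ideal_exp_ideal.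
  - by apply: idealD => //; exact: ideal_exp_ideal.
  - by apply: ideal_mull => //; exact: ideal_exp_ideal.
apply: nakayama; first exact: ideal_zero.
move=> t It; exists t; last by rewrite /= subrr.
move: t It; rewrite -/(_ `<=` _); set MI := ideal_mul M I.
have idMI : ideal MI by exact: ideal_smallest.
suff H K : ideal K -> MI `<=` K -> K `&` I `<=` MI -> I `<=` MI.
  by apply: (H MI) => // y [].
move: K; apply: (noetherian_ind T_noeth) => K idK IH MIK KI.
have [[B [idB KB BI]]|h] :=
    pselect (exists B, [/\ ideal B, K `<` B & B `&` I `<=` MI]).
  by apply: (IH B) => //; apply: subset_trans MIK _; case: KB.
suff [n MnK] : exists n, ideal_exp M n `<=` K.
  by move=> y Iy; apply: KI; split=> //; apply: MnK.
apply: exp_local_sub => // Q prQ KQ m Mm.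
suff [n /KQ] : exists n, K (m ^+ n) by exact: primeX.
have [n|n|n stop] := noetherian_acc T_noeth (J := fun n => colon K (m ^+ n)).
- exact: colon_ideal.
- by move=> y; rewrite /colon/= exprS mulrCA; exact: ideal_mull.
exists n; apply: contrapT => Kmn; apply: h; exists (adjoin K (m ^+ n)).
split; [exact: adjoin_ideal|exact: proper_adjoin|].
move=> y [[r Kyr] Iy]; apply: KI; split=> //.
rewrite -(subrK (r * m ^+ n) y); apply: idealD => //.
apply: stop; rewrite /colon/= exprS.
have -> : r * (m * m ^+ n) = m * y - m * (y - r * m ^+ n) by ring.
apply: idealB => //; last exact: ideal_mull.
by apply: MIK; exact: ideal_mul_mem.
Qed.

(** T/K has finite length. In the step from A + (a) down to A, the chain
    J n + (a) is stationary; once a has left the chain, an element of an earlier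
    term differs from one of a later term only by a nonunit multiple of a, and
    that lies in A. *)
Lemma local_dcc K (J : nat -> set T) : ideal K ->
  (forall Q, prime_ideal Q -> K `<=` Q -> M `<=` Q) ->
  (forall n, ideal (J n)) -> (forall n, K `<=` J n) ->
  (forall n, J n.+1 `<=` J n) ->
  exists n, forall k, (n <= k)%N -> J n `<=` J k.
Proof.
move=> idK KM; move: J.
apply: (finite_length_ind T_noeth (Pr := fun A => forall J : nat -> set T,
    (forall n, ideal (J n)) -> (forall n, A `<=` J n) ->
    (forall n, J n.+1 `<=` J n) ->
    exists n, forall k, (n <= k)%N -> J n `<=` J k) idK KM).
  by move=> J _ TJ _; exists 0%N => k _ x _; exact: TJ.
move=> A a idA _ Aa MaA IH J idJ AJ JS.
have Jle n k : (n <= k)%N -> J k `<=` J n.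
  move=> /subnK <-; elim: (k - n)%N => // i Ji.
  by apply: subset_trans Ji; exact: JS.
have [|||n nst] := IH (fun n => adjoin (J n) a).
- by move=> n; exact: adjoin_ideal.
- move=> n; apply: adjoin_sub; [exact: adjoin_ideal| |exact: mem_adjoin].
  exact: subset_trans (AJ n) (sub_adjoin _).
- move=> n; apply: adjoin_sub; [exact: adjoin_ideal| |exact: mem_adjoin].
  exact: subset_trans (JS n) (sub_adjoin _).
have [Ja|/existsNP[k0 Jk0]] := pselect (forall n, J n a).
  exists n => k nk x Jx; suff: adjoin (J k) a x by exact: adjoin_sub.
  by apply: nst => //; exact: sub_adjoin.
exists (maxn n k0) => k; rewrite geq_max => /andP[nk k0k] x Jx.
have Jnx : J n x by apply: Jle Jx; exact: leq_maxl.
have [r Jkr] := nst k nk x (sub_adjoin _ Jnx).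
rewrite -(subrK (r * a) x); apply: idealD => //; apply/(AJ k)/MaA.
(* r a lies in J k0 while a does not, so r is not a unit. *)
apply: contrapT => /local_unit[s s1]; apply: Jk0.
rewrite -[a]mul1r -s1 -mulrA; apply: ideal_mull => //.
have -> : r * a = x - (x - r * a) by ring.
apply: idealB => //; first by apply: Jle Jx; exact: leq_maxr.
exact: Jle Jkr.
Qed.

(** The heart of Krull's principal ideal theorem. Put
    S_n = (P + (w^n) : z^oo). The descending chain S_n + (z) is stationary, so
    S_n <= S_(n+1) + z S_n because z can be divided out in S_n, and
    S_n = S_(n+1) by Nakayama. Then z^k w^n is in P + (w^(n+1)), and cancelling w^n, which is
    not in the prime P, gives the claim. *)
Lemma principal_ideal_power P z w : prime_ideal P -> M z -> ~ P w ->
  (forall Q, prime_ideal Q -> P `<=` Q -> Q z -> M `<=` Q) ->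
  exists k, adjoin P w (z ^+ k).
Proof.
move=> prP Mz Pw onlyM; have idP := prime_is_ideal prP.
pose S n := [set t | exists k, adjoin P (w ^+ n) (z ^+ k * t)].
have idPw n : ideal (adjoin P (w ^+ n)) by exact: adjoin_ideal.
have idS n : ideal (S n).
  apply/idealP; split.
  - by exists 0%N; rewrite mulr0; exact: ideal0.
  - move=> x y [k Hk] [l Hl]; exists (l + k)%N.
    have -> : z ^+ (l + k) * (x + y) =
        z ^+ l * (z ^+ k * x) + z ^+ k * (z ^+ l * y) by rewrite exprD; ring.
    by apply: idealD => //; exact: ideal_mull.
  - by move=> c x [k Hk]; exists k; rewrite mulrCA; exact: ideal_mull.
have SS n : S n.+1 `<=` S n.
  move=> t [k Hk]; exists k; apply: adjoin_sub Hk => //; first exact: sub_adjoin.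
  by rewrite exprS; apply: ideal_mull => //; exact: mem_adjoin.
have [|Q prQ KQ||n|n|n stop] := @local_dcc (adjoin P z) (fun n => adjoin (S n) z).
- exact: adjoin_ideal.
- apply: onlyM => //; first exact: subset_trans (sub_adjoin _) KQ.
  exact/KQ/mem_adjoin.
- by move=> n; exact: adjoin_ideal.
- apply: adjoin_sub; [exact: adjoin_ideal| |exact: mem_adjoin].
  move=> x Px; apply: sub_adjoin; exists 0%N; rewrite mul1r; exact: sub_adjoin.
- apply: adjoin_sub; [exact: adjoin_ideal| |exact: mem_adjoin].
  exact: subset_trans (SS n) (sub_adjoin _).
have /(_ (w ^+ n)) Sw : S n `<=` S n.+1.
  apply: nakayama => // t St.
  have [r Sr] := stop n.+1 (leqnSn n) t (sub_adjoin _ St).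
  exists (z * r); last by rewrite [z * r]mulrC.
  apply: ideal_mul_mem => //.
  have [k Hk] : S n (r * z).
    have -> : r * z = t - (t - r * z) by ring.
    by apply: idealB => //; exact: SS.
  by exists k.+1; rewrite exprSr -mulrA [z * r]mulrC.
have [|k [r Pr]] := Sw; first by exists 0%N; rewrite mul1r; exact: mem_adjoin.
exists k, r; have : P (w ^+ n * (z ^+ k - r * w)).
  by move: Pr; rewrite exprS; congr P; ring.
by case/(primeM prP) => // /(primeX prP).
Qed.

(** A nonmaximal prime P' strictly above P prevents M from being minimal over
    P + (z): any w in P' outside P would satisfy z^k in P + (w) <= P'. *)
Lemma principal_ideal_theorem P P' z : prime_ideal P -> prime_ideal P' ->
  P `<` P' -> ~ M `<=` P' -> M z ->
  exists Q, [/\ prime_ideal Q, P `<=` Q, Q z & ~ M `<=` Q].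
Proof.
move=> prP prP' [PP' /existsNP[w /not_implyP[P'w Pw]]] MP' Mz.
apply: contrapT => noQ.
have onlyM Q : prime_ideal Q -> P `<=` Q -> Q z -> M `<=` Q.
  by move=> prQ PQ Qz; apply: contrapT => MQ; apply: noQ; exists Q.
have [k Pwz] := principal_ideal_power prP Mz Pw onlyM.
apply: MP'; apply: onlyM => //; apply: (primeX prP' (n := k)).
by apply: adjoin_sub Pwz => //; exact: prime_is_ideal.
Qed.

(** By Noetherian induction P may be taken maximal among the primes with two
    more steps up to M; then every prime strictly above P is M or lies just
    below it. Choose x in P' outside P, and y in M outside the nonmaximal
    minimal primes over P + (x). A prime over P + (x, y) contains one of those
    minimal primes; if that one is not M, the inclusion is strict because of y,
    so the prime is M. *)
Lemma two_parameters P P' : prime_ideal P -> prime_ideal P' ->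
  P `<` P' -> ~ M `<=` P' ->
  exists P1 P1' x y,
    [/\ prime_ideal P1, prime_ideal P1', P1 `<` P1' & ~ M `<=` P1'] /\
    [/\ M x, M y &
      forall Q, prime_ideal Q -> P1 `<=` Q -> Q x -> Q y -> M `<=` Q].
Proof.
move=> prP; have idP := prime_is_ideal prP; move: idP P' prP.
move: P; apply: (noetherian_ind T_noeth) => P idP IH P' prP prP' PP' MP'.
have [[B [B' [prB PB [prB' BB' MB']]]]|h] := pselect (exists B B',
    [/\ prime_ideal B, P `<` B & [/\ prime_ideal B', B `<` B' & ~ M `<=` B']]).
  exact: (IH B (prime_is_ideal prB) PB B' prB).
case: (PP') => _ /existsNP[x /not_implyP[P'x Px]].
have Mx : M x.
  by case/prime_idealP: prP' => idP' P'1 _; apply: (proper_sub_local idP').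
have [s [s1 s2]] := minimal_primes T_noeth (adjoin_ideal x idP).
have [|y My ys] := @prime_avoidance T M [seq Q <- s | `[< ~ M `<=` Q >]] idM.
  by move=> Q; rewrite mem_filter => /andP[/asboolP MQ /s1[]].
exists P, P', x, y; split=> //; split=> // Q prQ PQ Qx Qy.
have [|Q' Q's Q'Q] := s2 Q prQ.
  by apply: adjoin_sub => //; exact: prime_is_ideal.
have [MQ'|MQ'] := pselect (M `<=` Q'); first exact: subset_trans Q'Q.
have Q'y : ~ Q' y by apply: ys; rewrite mem_filter Q's andbT; exact/asboolP.
have [prQ' PxQ'] := s1 Q' Q's.
apply: contrapT => MQ; apply: h; exists Q', Q; split=> //.
  split; first exact: subset_trans (sub_adjoin _) PxQ'.
  by move/(_ x (PxQ' _ (mem_adjoin _ idP))).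
by split=> //; split=> // /(_ y Qy).
Qed.

End LocalRing.

(** * Power series and digit expansions in a complete local ring *)

Section Digits.
Variables (T : comNzRingType) (M : set T).
Hypothesis T_local : local_ring M.
Implicit Types (t u x y z : T) (a b : nat -> T) (s : seq T).

Let idM : ideal M := local_ideal T_local.

(** The value at y of the power series with coefficients a. Its Horner relation
    holds because both sides are limits of the same partial sums, and limits
    are unique by Krull's theorem. *)
Lemma power_series_eval y : adic_complete M -> M y ->
  exists L : (nat -> T) -> T, forall a, L a = a 0%N + y * L (fun n => a n.+1).
Proof.
move=> T_complete My; pose S a n := \sum_(i < n) a i * y ^+ i.
have idE n : ideal (ideal_exp M n) by exact: ideal_exp_ideal.
have SD a n i : ideal_exp M n (S a (i + n)%N - S a n).
  elim: i => [|i IH]; first by rewrite subrr; exact: ideal0.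
  rewrite addSn /S big_ord_recr /= addrAC; apply: idealD => //.
  apply: ideal_mull => //; apply: (@ideal_exp_le _ M n (i + n)%N (leq_addl _ _)).
  exact: ideal_exp_mem.
have cvS a : exists l, adic_cvg M (S a) l.
  apply: T_complete => n; exists n => i j ni nj.
  have -> : S a i - S a j = (S a i - S a n) - (S a j - S a n) by ring.
  by apply: idealB => //; [rewrite -(subnK ni)|rewrite -(subnK nj)].
have [L HL] := choice cvS; exists L => a.
apply/eqP; rewrite -subr_eq0; apply/eqP/(krull_intersection T_local) => n.
have [N1 H1] := HL a n; have [N2 H2] := HL (fun n => a n.+1) n.
pose N := maxn N1 N2.
have {}H1 : ideal_exp M n (S a N.+1 - L a).
  by apply: H1; rewrite (leq_trans (leq_maxl _ _) (leqnSn _)).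
have {}H2 := H2 N (leq_maxr _ _).
have SE : S a N.+1 = a 0%N + y * S (fun n => a n.+1) N.
  rewrite /S big_ord_recl mulr1 mulr_sumr; congr (_ + _).
  by apply: eq_bigr => i _; rewrite /= exprS; ring.
rewrite SE in H1.
set s' := S _ N in H1 H2.
have -> : L a - (a 0%N + y * L (fun n => a n.+1)) =
  y * (s' - L (fun n => a n.+1)) - (a 0%N + y * s' - L a) by ring.
by apply: idealB => //; exact: ideal_mull.
Qed.

(** A system of representatives of the residue field. *)
Definition residue_rep t : T := xget 0 [set r | M (t - r)].

Lemma residue_repP t : M (t - residue_rep t).
Proof.
apply: (@xgetPex _ 0 [set r | M (t - r)]).
by exists t; rewrite /= subrr; exact: ideal0.
Qed.

Lemma residue_rep_eq t u : M (t - u) -> residue_rep t = residue_rep u.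
Proof.
move=> Mtu; rewrite /residue_rep; congr xget; apply/seteqP; split=> r /= Mr.
  have -> : u - r = (t - r) - (t - u) by ring.
  exact: idealB.
have -> : t - r = (u - r) + (t - u) by ring.
exact: idealD.
Qed.

Lemma residue_rep_inj t u :
  M (residue_rep t - residue_rep u) -> residue_rep t = residue_rep u.
Proof.
move=> Mr; apply: residue_rep_eq.
have -> : t - u = (t - residue_rep t) - (u - residue_rep u)
   + (residue_rep t - residue_rep u) by ring.
by apply: idealD => //; apply: idealB => //; exact: residue_repP.
Qed.

Definition digit_seq : set (nat -> T) :=
  [set a | forall n, exists t, a n = residue_rep t].

(** Two digit expansions in powers of y first differ by a unit times a power of
    y, which no prime without y contains. *)
Lemma power_series_inj y (L : (nat -> T) -> T) Q a b :
  M y -> (forall a, L a = a 0%N + y * L (fun n => a n.+1)) ->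
  prime_ideal Q -> ~ Q y -> digit_seq a -> digit_seq b ->
  Q (L a - L b) -> a = b.
Proof.
move=> My HL prQ Qy da db QL; have idQ := prime_is_ideal prQ.
suff H n : forall a b, digit_seq a -> digit_seq b -> Q (L a - L b) -> a n = b n.
  by apply/funext => n; exact: H.
have first a' b' : digit_seq a' -> digit_seq b' -> Q (L a' - L b') ->
    a' 0%N = b' 0%N.
  move=> da' db' QL'; have [[t at_] [u bu]] := (da' 0%N, db' 0%N).
  rewrite at_ bu; apply: residue_rep_inj; rewrite -at_ -bu.
  have -> : a' 0%N - b' 0%N = (L a' - L b') -
      y * (L (fun n => a' n.+1) - L (fun n => b' n.+1)).
    by rewrite (HL a') (HL b'); ring.
  apply: idealB => //; last exact: ideal_mulr.
  case/prime_idealP: prQ => _ Q1 _; exact: (proper_sub_local T_local idQ).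
elim: n => [|n IH] {da db QL}a {}b da db QL; first exact: first.
apply: (IH (fun n => a n.+1) (fun n => b n.+1)) => [i|i|]; [exact: da|exact: db|].
have : Q (y * (L (fun n => a n.+1) - L (fun n => b n.+1))).
  by move: (QL); rewrite (HL a) (HL b) (first a b da db QL); congr Q; ring.
by case/(primeM prQ).
Qed.

(** Expand t = rep t + sum_i c_i m_i over generators m_i of M, then expand each
    c_i, and so on: t is determined modulo M^n by the representatives met along
    words of length below n, hence, by Krull's theorem, by all of them. Words
    over nat are countable, so this is a sequence of digits. *)
Lemma digit_expansion : exists c : T -> nat -> T,
  injective c /\ forall t, digit_seq (c t).
Proof.
have [s Ms] := local_noetherian T_local idM.
have coefP t : exists e : nat -> T,
    t = residue_rep t + \sum_(i < size s) e i * s`_i.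
  have [|e te] := @ideal_gen_seqP T s (t - residue_rep t).
    by rewrite -Ms; exact: residue_repP.
  by exists e; rewrite -te addrC subrK.
have [coef Hcoef] := choice coefP.
pose word n : seq nat := odflt [::] (unpickle n).
exists (fun t n => residue_rep (foldl coef t (word n))); split; last first.
  by move=> t n; eexists.
move=> t u tu.
have {}tu w : residue_rep (foldl coef t w) = residue_rep (foldl coef u w).
  by have := congr1 (fun f => f (pickle w)) tu; rewrite /word pickleK.
apply/eqP; rewrite -subr_eq0; apply/eqP/(krull_intersection T_local) => n.
elim: n t u tu => [//|n IH] t u tu.
rewrite (Hcoef t) (Hcoef u) (tu [::]) opprD addrACA subrr add0r -sumrB.
apply: ideal_sum => [|i]; first exact: ideal_exp_ideal.
rewrite -mulrBl mulrC; apply: ideal_mul_mem.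
  by rewrite Ms; apply: sub_gen_smallest; exact: mem_nth.
by apply: IH => w; exact: (tu (nat_of_ord i :: w)).
Qed.

Lemma residue_rep01 : residue_rep 0 <> residue_rep 1.
Proof.
move=> e; case: (local_proper T_local) => _; apply.
have -> : 1 = (1 - residue_rep 1) - (0 - residue_rep 0) by rewrite e; ring.
by apply: idealB => //; exact: residue_repP.
Qed.

(** Row 0 records the length in unary, row i+1 the digits of the i-th entry. *)
Lemma digit_expansion_seq : exists c : seq T -> nat -> T,
  injective c /\ forall s, digit_seq (c s).
Proof.
have [c [cI cD]] := digit_expansion.
pose row s i j := if i is i'.+1 then c s`_i' j else residue_rep (j < size s)%:R.
pose pos n : nat * nat := odflt (0, 0)%N (unpickle n).
exists (fun s n => row s (pos n).1 (pos n).2); split; last first.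
  by move=> s n; case: (pos n) => -[|i] j /=; [eexists|exact: cD].
move=> s s' ss'.
have {ss'} E i j : row s i j = row s' i j.
  by have := congr1 (fun f => f (pickle (i, j))) ss'; rewrite /pos pickleK.
have szE : size s = size s'.
  have [l|l|//] := ltngtP (size s) (size s').
    by case: residue_rep01; have := E 0%N (size s); rewrite /= ltnn l.
  by case: residue_rep01; have := E 0%N (size s'); rewrite /= ltnn l.
apply: (eq_from_nth (x0 := 0)) => // i _; apply: cI.
by apply/funext => j; exact: (E i.+1 j).
Qed.

End Digits.

(** * Counting primes *)

Lemma card_le_inj (U V : Type) (A : set U) (B : set V) (f : U -> V) :
  {in A &, injective f} -> (forall x, A x -> B (f x)) -> A #<= B.
Proof.
move=> fI fAB; rewrite -(card_le_eql (inj_card_eq fI)).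
by apply: subset_card_le => _ [x Ax <-]; exact: fAB.
Qed.

Lemma uncountable_bool_seq : ~ countable [set: nat -> bool].
Proof.
move=> /countable_injP[f fI].
pose d n := `[< forall b, f b = n -> ~~ b n >].
have dE : d (f d) = ~~ d (f d).
  apply/idP/idP => [|ndf].
    by rewrite {1}/d => /asboolP/(_ d erefl).
  by apply/asboolP => b /fI -> //; exact: mem_set.
by case: (d (f d)) dE.
Qed.

(** The primes over P + (x - y L(a)), with a a digit sequence: one of them is
    nonmaximal, by the principal ideal theorem, so it avoids y, as otherwise it
    would contain x as well. A prime without y cannot serve two sequences,
    since it would contain y (L(a) - L(b)). *)
Lemma digit_seq_primes (T : comNzRingType) (M : set T) :
  local_ring M -> adic_complete M -> (2%:E <= krull_dim T)%E ->
  exists (L : (nat -> T) -> T) (Q : (nat -> T) -> set T),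
    [/\ forall a, Spec T (Q a),
        {in digit_seq M &, injective L} &
        {in digit_seq M &, injective Q}].
Proof.
move=> T_local T_complete /le_krull_dimP[n n2 [p [pS plt]]].
have [n0 n1] : (0 < n)%N /\ (1 < n)%N by rewrite (ltn_trans _ n2).
have idM := local_ideal T_local.
have Mp1 : ~ M `<=` p 1%N.
  move=> Mp1; have [_ p21] := plt 1%N n1; apply: p21.
  apply: subset_trans Mp1; case/prime_idealP: (pS 2%N n2) => idp p1 _.
  exact: (proper_sub_local T_local).
have [P [P' [x [y [[prP prP' PP' MP'] [Mx My onlyM]]]]]] :=
  two_parameters T_local (pS 0%N (leq0n _)) (pS 1%N n0) (plt 0%N n0) Mp1.
have [L HL] := power_series_eval T_local T_complete My.
have primeQ a : exists Q, [/\ prime_ideal Q, Q (x - y * L a) & ~ Q y].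
  have [|Q [prQ PQ Qz MQ]] :=
      principal_ideal_theorem T_local (z := x - y * L a) prP prP' PP' MP'.
    by apply: idealB => //; exact: ideal_mulr.
  exists Q; split=> // Qy; apply: MQ; apply: onlyM => //.
  have idQ := prime_is_ideal prQ.
  by rewrite -(subrK (y * L a) x); apply: idealD => //; exact: ideal_mulr.
have [Q HQ] := choice primeQ; exists L, Q; split=> [a|a b|a b].
- by case: (HQ a).
- move=> /set_mem da /set_mem db Lab; have [prQ _ Qy] := HQ a.
  apply: (power_series_inj T_local My HL prQ Qy da db).
  by rewrite Lab subrr; apply: ideal0; exact: prime_is_ideal.
- move=> /set_mem da /set_mem db Qab.
  have [[prQ Qa Qy] [_ Qb _]] := (HQ a, HQ b); rewrite -Qab in Qb.
  apply: (power_series_inj T_local My HL prQ Qy da db).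
  have : Q a (y * (L a - L b)).
    have -> : y * (L a - L b) = (x - y * L b) - (x - y * L a) by ring.
    by apply: idealB => //; exact: prime_is_ideal.
  by case/(primeM prQ).
Qed.

Theorem theorem3p5 (T : comNzRingType) (M : set T)
  (T_local : local_ring M) (T_complete : adic_complete M)
  (T_dim : (2%:E <= krull_dim T)%E) :
  [/\ Spec T #= [set: T], ~ countable [set: T] & ~ countable (Spec T)].
Proof.
have [L [Q [QS LI QI]]] := digit_seq_primes T_local T_complete T_dim.
have [c [cI cD]] := digit_expansion T_local.
have [d [dI dD]] := digit_expansion_seq T_local.
have card_eqST : Spec T #= [set: T].
  rewrite card_eq_le; apply/andP; split; last first.
    apply: (@card_le_inj _ _ _ _ (Q \o c)) => [t u _ _ /= Qtu|t _]; last exact: QS.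
    by apply/cI/QI => //; apply/mem_set; exact: cD.
  have gensP (I : set T) : exists s : seq T, ideal I -> I = ideal_gen [set` s].
    have [/(local_noetherian T_local)[s ->]|] := pselect (ideal I).
      by exists s.
    by exists [::].
  have [gens Hg] := choice gensP.
  apply: (@card_le_inj _ _ _ _ (L \o d \o gens)) => // P P'.
  move=> /set_mem /prime_is_ideal idP /set_mem /prime_is_ideal idP' /= LPP'.
  rewrite (Hg P idP) (Hg P' idP'); suff -> : gens P = gens P' by [].
  by apply/dI/LI => //; apply/mem_set; exact: dD.
have uncT : ~ countable [set: T].
  move=> cT; apply: uncountable_bool_seq; apply: sub_countable cT.
  pose bit (b : nat -> bool) n := residue_rep M (b n)%:R.
  apply: (@card_le_inj _ _ _ _ (L \o bit)) => // b b' _ _ /= Lbb'.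
  apply/funext => n.
  have : bit b n = bit b' n.
    congr (_ n); apply: LI => //; apply/mem_set => i; by eexists.
  have := residue_rep01 T_local.
  by rewrite /bit; case: (b n) (b' n) => -[] // h e; case: h.
by split=> //; rewrite (eq_countable card_eqST).
Qed.
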